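(* Assume $p_0\in(0,1)$, $p_j\in(0,1)$ and $\tau_j=\frac{p_0}{p_0+2(1-p_0)p_j}$ for $j=1,\dots,k$. Let $\Theta^0\in\mathbb R^{nd}$ be arbitrary, let $\xi^{(0)},\xi^{(1)},\dots$ be i.i.d. copies of $\xi$, and define iterates $\Theta^{t+1}=\Theta^t-\eta\,G(\Theta^t;\xi^{(t)})$. If $0<\eta\le\frac{1}{2\mathcal L}$, then for all $t\ge0$, $$\mathbb E\|\Theta^t-\hat\Theta\|^2\le(1-\eta\mu)^t\|\Theta^0-\hat\Theta\|^2+\frac{2\eta\,\sigma^2_{\hat\Theta}}{\mu}.$$
   Context: Clients $1,\dots,n$ are partitioned into nonempty disjoint clusters $\mathcal I_1,\dots,\mathcal I_k$; $d\ge1$. Each $f_i:\mathbb R^d\to\mathbb R$ is differentiable, $\mu$-strongly convex and $L$-smooth ($0<\mu\le L$). Fix $\gamma_i>0$ and $\alpha_j\in[0,1]$, not all $\alpha_j=0$. For $\Theta=(\theta_1,\dots,\theta_n)$ let $\Theta_j$ be the stacked vector of $\theta_i$, $i\in\mathcal I_j$; define $\bar\theta_j=\frac{\sum_{i\in\mathcal I_j}\gamma_i\theta_i}{\sum_{i\in\mathcal I_j}\gamma_i}$, $\bar\theta=\frac{\sum_{j}\sum_{i\in\mathcal I_j}\alpha_j\gamma_i\theta_i}{\sum_{j}\sum_{i\in\mathcal I_j}\alpha_j\gamma_i}$, $\psi_j(\Theta_j)=\frac12\sum_{i\in\mathcal I_j}\gamma_i\|\theta_i-\bar\theta_j\|^2$,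 $\varphi(\Theta)=\frac12\sum_{j}\alpha_j\sum_{i\in\mathcal I_j}\gamma_i\|\theta_i-\bar\theta\|^2$, $F_j(\Theta_j)=\sum_{i\in\mathcal I_j}f_i(\theta_i)$, and $F(\Theta)=\sum_jF_j(\Theta_j)+\sum_j(1-\alpha_j)\psi_j(\Theta_j)+\varphi(\Theta)$; $\hat\Theta$ is its unique minimizer. Gradient oracle: $\xi=(\xi_0,\dots,\xi_k)$ independent Bernoulli with $\mathbb P(\xi_j=1)=p_j$; $G(\Theta;\xi)=(G_1,\dots,G_n)$ with, for $i\in\mathcal I_j$: $G_i=\frac{\gamma_i\alpha_j}{p_0}(\theta_i-\bar\theta)+\frac{\gamma_i\tau_j(1-\alpha_j)}{p_0}(\theta_i-\bar\theta_j)$ if $\xi_0=1$; $G_i=\frac{\gamma_i(1-\tau_j)(1-\alpha_j)}{(1-p_0)p_j}(\theta_i-\bar\theta_j)$ if $\xi_0=0,\xi_j=1$; $G_i=\frac{1}{(1-p_0)(1-p_j)}\nabla f_i(\theta_i)$ if $\xi_0=\xi_j=0$. Define $\mathcal L=\max\big\{\frac{2}{p_0}\max_{j}\max_{i\in\mathcal I_j}\alpha_j\gamma_i,\ \max_{j}\frac{2(1-\alpha_j)\max_{i\in\mathcal I_j}\gamma_i}{p_0+2(1-p_0)p_j},\ \frac{L}{1-p_0}\max_{j}\frac{1}{1-p_j}\big\}$ and $\sigma^2_{\hat\Theta}=\frac{2}{p_0}\|\nabla\varphi(\hat\Theta)\|^2+\sum_{j=1}^k\frac{2(1-\alpha_j)^2}{p_0+2(1-p_0)p_j}\|\nabla\psi_j(\hat\Theta_j)\|^2+\frac{1}{1-p_0}\sum_{j=1}^k\frac{1}{1-p_j}\|\nabla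 F_j(\hat\Theta_j)\|^2$. *)

(* Defs.v *)
From HB Require Import structures.
From mathcomp Require Import all_boot all_order all_algebra.
From mathcomp Require Import all_classical all_reals all_analysis.
Set Implicit Arguments. Unset Strict Implicit. Unset Printing Implicit Defensive.
Import Order.TTheory GRing.Theory Num.Theory.
Import numFieldNormedType.Exports.
Local Open Scope ring_scope.

Definition sqn {R : realType} {m n : nat} (M : 'M[R]_(m, n)) : R :=
  \sum_(i < m) \sum_(l < n) M i l ^+ 2.

Definition dotm {R : realType} {m n : nat} (A B : 'M[R]_(m, n)) : R :=
  \sum_(i < m) \sum_(l < n) A i l * B i l.

Definition grad {R : realType} {m n : nat} (f : 'M[R]_(m, n) -> R)
  (x : 'M[R]_(m, n)) : 'M[R]_(m, n) :=
  \matrix_(i, l) ('d f x (delta_mx i l : 'M[R]_(m, n))).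

Definition strongly_convex {R : realType} {d : nat} (mu : R)
  (f : 'rV[R]_d -> R) : Prop :=
  forall (x y : 'rV[R]_d) (lam : R), 0 <= lam <= 1 ->
    f (lam *: x + (1 - lam) *: y) <=
      lam * f x + (1 - lam) * f y - mu / 2 * lam * (1 - lam) * sqn (x - y).

Definition smooth_L {R : realType} {d : nat} (L : R) (f : 'rV[R]_d -> R) : Prop :=
  forall x y : 'rV[R]_d,
    Num.sqrt (sqn (grad f x - grad f y)) <= L * Num.sqrt (sqn (x - y)).

Section Model.
Context {R : realType} {n d k : nat}.
(* c i = the cluster j such that client i belongs to I_j *)
Variable (c : 'I_n -> 'I_k) (gamma : 'I_n -> R) (alpha : 'I_k -> R).

(* Theta : 'M_(n,d), row i is theta_i *)
Definition bar_j (j : 'I_k) (Th : 'M[R]_(n, d)) : 'rV[R]_d :=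
  (\sum_(i | c i == j) gamma i)^-1 *: \sum_(i | c i == j) gamma i *: row i Th.

Definition bar (Th : 'M[R]_(n, d)) : 'rV[R]_d :=
  (\sum_i alpha (c i) * gamma i)^-1 *: \sum_i (alpha (c i) * gamma i) *: row i Th.

Definition psi (j : 'I_k) (Th : 'M[R]_(n, d)) : R :=
  2^-1 * \sum_(i | c i == j) gamma i * sqn (row i Th - bar_j j Th).

Definition phi (Th : 'M[R]_(n, d)) : R :=
  2^-1 * \sum_(j < k) alpha j * \sum_(i | c i == j) gamma i * sqn (row i Th - bar Th).

Variable (f : 'I_n -> 'rV[R]_d -> R).

Definition Fj (j : 'I_k) (Th : 'M[R]_(n, d)) : R :=
  \sum_(i | c i == j) f i (row i Th).

Definition Fobj (Th : 'M[R]_(n, d)) : R :=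
  \sum_(j < k) Fj j Th + \sum_(j < k) (1 - alpha j) * psi j Th + phi Th.

(* A realization of xi = (xi_0, xi_1, ..., xi_k). *)
Definition draw := (bool * {ffun 'I_k -> bool})%type.

Variable (p0 : R) (p : 'I_k -> R) (tau : 'I_k -> R).

Definition Pdraw (w : draw) : R :=
  (if w.1 then p0 else 1 - p0) * \prod_(j < k) (if w.2 j then p j else 1 - p j).

Definition Gi (Th : 'M[R]_(n, d)) (w : draw) (i : 'I_n) : 'rV[R]_d :=
  let j := c i in
  if w.1 then
    (gamma i * alpha j / p0) *: (row i Th - bar Th)
    + (gamma i * tau j * (1 - alpha j) / p0) *: (row i Th - bar_j j Th)
  else if w.2 j then
    (gamma i * (1 - tau j) * (1 - alpha j) / ((1 - p0) * p j)) *: (row i Th - bar_j j Th)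
  else ((1 - p0) * (1 - p j))^-1 *: grad (f i) (row i Th).

Definition Gor (Th : 'M[R]_(n, d)) (w : draw) : 'M[R]_(n, d) :=
  \matrix_(i < n) Gi Th w i.

Variable (eta : R) (Th0 : 'M[R]_(n, d)).

Fixpoint iterate (om : nat -> draw) (t : nat) : 'M[R]_(n, d) :=
  match t with
  | O => Th0
  | S t' => iterate om t' - eta *: Gor (iterate om t') (om t')
  end.

Definition default_draw : draw := (false, [ffun => false]).

Definition ext_seq (t : nat) (w : {ffun 'I_t -> draw}) : nat -> draw :=
  fun s => match insub s with Some s' => w s' | None => default_draw end.

(* E || Theta^t - That ||^2 for i.i.d. xi^(0), ..., xi^(t-1) (xi is
   finitely supported, so the expectation is a finite weighted sum). *)
Definition expected_sqdist (t : nat) (That : 'M[R]_(n, d)) : R :=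
  \sum_(w : {ffun 'I_t -> draw})
     (\prod_(s < t) Pdraw (w s)) * sqn (iterate (ext_seq w) t - That).

Variable (L : R).

Definition calL : R :=
  Num.max (Num.max
    (2 / p0 * \big[Num.max/0]_(i < n) (alpha (c i) * gamma i))
    (\big[Num.max/0]_(j < k)
        (2 * (1 - alpha j) * (\big[Num.max/0]_(i | c i == j) gamma i)
          / (p0 + 2 * (1 - p0) * p j))))
    (L / (1 - p0) * \big[Num.max/0]_(j < k) (1 - p j)^-1).

Definition sigma2 (That : 'M[R]_(n, d)) : R :=
  2 / p0 * sqn (grad phi That)
  + \sum_(j < k) (2 * (1 - alpha j) ^+ 2 / (p0 + 2 * (1 - p0) * p j))
                   * sqn (grad (psi j) That)
  + (1 - p0)^-1 * \sum_(j < k) (1 - p j)^-1 * sqn (grad (Fj j) That).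

End Model.

(* Main.v *)
(**
  Row by row, the oracle is an unbiased estimate of the gradient of the objective,
  and [tau] is the value that balances the two occurrences of [psi_j], so that the
  second moment of [G] at [X] is at most [noise X]; at the minimizer this bound is
  exactly [sigma2].  Each summand of the objective has its squared gradient
  difference controlled by its Bregman divergence (co-coercivity for the [f i],
  direct computation for the quadratics [psi_j] and [phi]), and first-order
  optimality makes the total Bregman divergence at [That] at most
  [F X - F That]; hence [noise X <= 4 calL (F X - F That) + 2 sigma2].  With
  strong convexity, one step multiplies the expected squared distance by
  [1 - eta mu] up to the additive error [2 eta^2 sigma2], and the recursion is
  iterated.
*)
Require Import Defs.
From HB Require Import structures.
From mathcomp Require Import all_boot all_order all_algebra.
From mathcomp Require Import all_classical all_reals all_analysis.
From mathcomp Require Import ring lra.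
Import Order.TTheory GRing.Theory Num.Theory.
Import numFieldNormedType.Exports.
Local Open Scope ring_scope.

(** * Dot product and gradient *)

Section DotProduct.
Context {R : realType} {m n : nat}.
Implicit Types (A B C : 'M[R]_(m, n)) (a : R).

Lemma sqnE A : sqn A = dotm A A.
Proof. by apply: eq_bigr => i _; apply: eq_bigr => l _; rewrite expr2. Qed.

Lemma sqn_ge0 A : 0 <= sqn A.
Proof. by apply: sumr_ge0 => i _; apply: sumr_ge0 => l _; exact: sqr_ge0. Qed.

Lemma dotmC A B : dotm A B = dotm B A.
Proof. by apply: eq_bigr => i _; apply: eq_bigr => l _; rewrite mulrC. Qed.

Lemma dotmDr A B C : dotm A (B + C) = dotm A B + dotm A C.
Proof.
rewrite -big_split; apply: eq_bigr => i _; rewrite -big_split.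
by apply: eq_bigr => l _; rewrite mxE mulrDr.
Qed.

Lemma dotmZr a A B : dotm A (a *: B) = a * dotm A B.
Proof.
rewrite mulr_sumr; apply: eq_bigr => i _; rewrite mulr_sumr.
by apply: eq_bigr => l _; rewrite mxE mulrCA.
Qed.

Lemma dotmNr A B : dotm A (- B) = - dotm A B.
Proof. by rewrite -scaleN1r dotmZr mulN1r. Qed.

Lemma dotmBr A B C : dotm A (B - C) = dotm A B - dotm A C.
Proof. by rewrite dotmDr dotmNr. Qed.

Lemma dotmDl A B C : dotm (A + B) C = dotm A C + dotm B C.
Proof. by rewrite dotmC dotmDr !(dotmC C). Qed.

Lemma dotmZl a A B : dotm (a *: A) B = a * dotm A B.
Proof. by rewrite dotmC dotmZr dotmC. Qed.

Lemma dotmNl A B : dotm (- A) B = - dotm A B.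
Proof. by rewrite dotmC dotmNr dotmC. Qed.

Lemma dotmBl A B C : dotm (A - B) C = dotm A C - dotm B C.
Proof. by rewrite dotmDl dotmNl. Qed.

Lemma dotm0r A : dotm A 0 = 0.
Proof. by rewrite -(scale0r (0 : 'M[R]_(m, n))) dotmZr mul0r. Qed.

Lemma dotm0l A : dotm 0 A = 0.
Proof. by rewrite dotmC dotm0r. Qed.

Lemma dotm_suml I (r : seq I) (P : pred I) (F : I -> 'M[R]_(m, n)) B :
  dotm (\sum_(i <- r | P i) F i) B = \sum_(i <- r | P i) dotm (F i) B.
Proof.
by apply: (big_morph (fun A => dotm A B) _ (dotm0l B)) => A C; exact: dotmDl.
Qed.

Definition dotmE := (dotmDl, dotmDr, dotmNl, dotmNr, dotmZl, dotmZr).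

Lemma sqnZ a A : sqn (a *: A) = a ^+ 2 * sqn A.
Proof. by rewrite !sqnE !dotmE mulrA expr2. Qed.

Lemma sqnN A : sqn (- A) = sqn A.
Proof. by rewrite !sqnE !dotmE opprK. Qed.

Lemma sqnD A B : sqn (A + B) = sqn A + 2 * dotm A B + sqn B.
Proof. by rewrite !sqnE !dotmE (dotmC B A); ring. Qed.

Lemma sqn0 : sqn (0 : 'M[R]_(m, n)) = 0.
Proof. by rewrite sqnE dotm0r. Qed.

Lemma sqnD_le A B : sqn (A + B) <= 2 * sqn A + 2 * sqn B.
Proof. by have := sqn_ge0 (A - B); rewrite !sqnD sqnN dotmNr; lra. Qed.

(** Expand the nonnegative [a * sqn (a^-1 *: A + s *: B)]; the signs [s = 1] and [s = -1] together
    give the absolute value. *)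
Lemma dotm_young a A B : 0 < a -> 2 * `|dotm A B| <= a^-1 * sqn A + a * sqn B.
Proof.
move=> a0.
have sgn s : s ^+ 2 = 1 -> - (2 * s * dotm A B) <= a^-1 * sqn A + a * sqn B.
  move=> s1; have := mulr_ge0 (ltW a0) (sqn_ge0 (a^-1 *: A + s *: B)).
  rewrite sqnD !sqnZ s1 !dotmE mul1r.
  have -> : a * (a^-1 ^+ 2 * sqn A + 2 * (s * (a^-1 * dotm A B)) + sqn B)
    = a^-1 * sqn A + a * sqn B + 2 * s * dotm A B by field; rewrite gt_eqF.
  lra.
have h1 := sgn 1 (expr1n _ _); have h2 : - (2 * -1 * dotm A B) <= a^-1 * sqn A + a * sqn B.
  by apply: sgn; rewrite sqrrN expr1n.
by case: (ger0P (dotm A B)) => _; lra.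
Qed.

End DotProduct.

Lemma sqn_row {R : realType} {m n : nat} (A : 'M[R]_(m, n)) :
  sqn A = \sum_i sqn (row i A).
Proof.
apply: eq_bigr => i _; rewrite /sqn big_ord1.
by apply: eq_bigr => l _; rewrite mxE.
Qed.

Lemma dotm_row {R : realType} {m n : nat} (A B : 'M[R]_(m, n)) :
  dotm A B = \sum_i dotm (row i A) (row i B).
Proof.
apply: eq_bigr => i _; rewrite /dotm big_ord1.
by apply: eq_bigr => l _; rewrite !mxE.
Qed.

Lemma dotm_delta {R : realType} {m n : nat} (A : 'M[R]_(m, n)) i l :
  dotm A (delta_mx i l) = A i l.
Proof.
rewrite /dotm (bigD1 i) //= (bigD1 l) //= big1 ?addr0; last first.
  by move=> l' /negPf nl; rewrite mxE nl andbF mulr0.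
rewrite big1 ?addr0; last first.
  by move=> i' /negPf ni; apply: big1 => l' _; rewrite mxE ni mulr0.
by rewrite mxE !eqxx mulr1.
Qed.

Section Gradient.
Context {R : realType} {m n : nat}.
Implicit Types (f : 'M[R]_(m, n) -> R) (x h A : 'M[R]_(m, n)).

Lemma diff_grad f x h : 'd f x h = dotm (grad f x) h.
Proof.
rewrite [in LHS](matrix_sum_delta h) linear_sum; apply: eq_bigr => i _.
rewrite linear_sum; apply: eq_bigr => l _.
by rewrite linearZ mxE mulrC.
Qed.

Lemma le_mx_norm_entry x i l : `|x i l| <= `|x|.
Proof.
rewrite [leRHS]mx_normrE.
exact: (le_bigmax _ (fun ij : 'I_m * 'I_n => `|x ij.1 ij.2|) (i, l)).
Qed.

(** The ambient matrix norm is the max norm. This comparison turns remainders quadratic in [sqn]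
    into little-o terms for that norm. *)
Lemma sqn_le_norm x : sqn x <= (m * n)%:R * `|x| ^+ 2.
Proof.
have -> : (m * n)%:R * `|x| ^+ 2 = \sum_(i < m) \sum_(l < n) `|x| ^+ 2.
  by rewrite !sumr_const !card_ord -mulrnA mulr_natl mulnC.
apply: ler_sum => i _; apply: ler_sum => l _.
by rewrite -real_normK ?num_real// lerXn2r ?nnegrE// le_mx_norm_entry.
Qed.

Lemma dotm_continuous A : continuous (dotm A).
Proof.
rewrite /dotm.  apply: (continuous_big) => [|i _]; first exact: add_continuous.
apply: (continuous_big) => [|l _ x]; first exact: add_continuous.
have cx := @coord_continuous R m n i l x. exact: (cvgMl_tmp (F := nbhs x)).
Qed.

Lemma dotm_linear A : linear (dotm A).
Proof. by move=> a x h; rewrite dotmDr dotmZr. Qed.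

HB.instance Definition _ A :=
  GRing.isLinear.Build R 'M[R]_(m, n) R *:%R (dotm A) (dotm_linear A).

(** A quadratic remainder is little-o of [h], so [dotm A] is the differential by uniqueness.
    Gradients can thus be read off second-order expansions. *)
Lemma grad_eq f x A (C : R) :
  (forall h, `|f (x + h) - f x - dotm A h| <= C * sqn h) -> grad f x = A.
Proof.
move=> fA.
have dfx : 'd f x = dotm A :> (_ -> _).
  apply: diff_unique; first exact: dotm_continuous.
  apply/eqaddoP => e e0.
  (* The [+ 1] keeps [D] positive in every case; [D * |h| <= e] is what the little-o bound asks
     for. *)
  pose D : R := `|C| * (m * n)%:R + 1.
  have D0 : 0 < D by rewrite ltr_wpDl// mulr_ge0.
  near=> h.
  have -> : (f \o shift x - (cst (f x) + dotm A)) h = f (x + h) - f x - dotm A h.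
    by rewrite !fctE /= [h + x]addrC opprD addrA.
  apply: le_trans (fA h) _.
  have hD : `|h| <= e / D.
    by near: h; exact: (@nbhs0_le R 'M[R]_(m, n) _ (divr_gt0 e0 D0)).
  apply: (@le_trans _ _ (D * `|h| ^+ 2)).
    apply: (@le_trans _ _ (`|C| * sqn h)).
      by rewrite ler_wpM2r ?sqn_ge0// ler_norm.
    apply: (@le_trans _ _ (`|C| * ((m * n)%:R * `|h| ^+ 2))).
      by rewrite ler_wpM2l// sqn_le_norm.
    by rewrite mulrA ler_wpM2r ?sqr_ge0// lerDl.
  by rewrite expr2 mulrA ler_wpM2r// -ler_pdivlMl// mulrC.
by apply/matrixP => i l; rewrite mxE dfx dotm_delta.
Unshelve. all: by end_near.
Qed.

Lemma is_derive_line f x h (t : R) : differentiable f (x + t *: h) ->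
  is_derive t 1 (fun s : R => f (x + s *: h)) (dotm (grad f (x + t *: h)) h).
Proof.
move=> fd; rewrite -diff_grad -deriveE//.
have E : (fun s : R => s^-1 *: ((fun s => f (x + s *: h)) (s *: (1 : R) + t) - f (x + t *: h)))
   = (fun s => s^-1 *: (f (s *: h + (x + t *: h)) - f (x + t *: h))).
  apply/funext => s; congr (_ *: (f _ - _)).
  by rewrite scalerDl [s *: 1]mulr1 addrCA.
have := @diff_derivable _ _ _ _ _ h fd.
split; rewrite /derivable /derive E//.
Qed.
End Gradient.

(** * Smooth and strongly convex functions *)

Section SmoothConvex.
Context {R : realType} {d : nat}.
Variables (f : 'rV[R]_d -> R) (mu L : R).
Hypotheses (L_gt0 : 0 < L) (f_diff : forall x, differentiable f x).
Hypotheses (f_smooth : smooth_L L f) (f_cvx : strongly_convex mu f).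
Implicit Types x y h : 'rV[R]_d.

Lemma sqn_grad_lipschitz x y : sqn (grad f x - grad f y) <= L ^+ 2 * sqn (x - y).
Proof.
rewrite -(sqr_sqrtr (sqn_ge0 (grad f x - grad f y))) -(sqr_sqrtr (sqn_ge0 (x - y))).
have L0 := ltW L_gt0.
by rewrite -exprMn lerXn2r ?nnegrE ?mulr_ge0 ?sqrtr_ge0.
Qed.

(** Instead of integrating the gradient along the segment, apply the mean value theorem on [0, 1] to
    the signed remainder minus its quadratic bound, whose derivative is nonpositive; [s] covers both
    signs. *)
Lemma descent_lemma x h :
  `|f (x + h) - f x - dotm (grad f x) h| <= L / 2 * sqn h.
Proof.
set a := dotm (grad f x) h.
suff sgn (s : R) : `|s| = 1 -> s * (f (x + h) - f x - a) <= L / 2 * sqn h.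
  have h1 := sgn 1 (normr1 _); have h2 := sgn (-1) (normrN1 _).
  by rewrite ler_norml; apply/andP; split; lra.
move=> s1.
pose k (t : R) : R := s * (f (x + t *: h) - a * t) - L / 2 * sqn h * t ^+ 2.
pose dk (t : R) := s * (dotm (grad f (x + t *: h)) h - a) - t * (L * sqn h).
have kd (t : R) : is_derive t 1 k (dk t).
  have fd := is_derive_line f x h t (f_diff (x + t *: h)).
  have := is_deriveB (is_deriveZ s (is_deriveB fd (is_deriveZ a (is_derive_id t 1))))
    (is_deriveZ (L / 2 * sqn h) (is_deriveX 2 (is_derive_id t 1))).
  move=> /is_derive_eq; apply.
  by rewrite /GRing.scale/= expr1 /dk; move: (dotm _ _) (sqn h) => u v; field.
have kc : {within `[0, 1], continuous k}%classic.
  by apply: derivable_within_continuous => t _; exact: ex_derive.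
have [c] := MVT ltr01 (fun t _ => kd t) kc.
rewrite in_itv/= => /andP[c0 c1] kE.
have : dk c <= 0.
  rewrite subr_le0 -dotmBl.
  apply: le_trans (ler_norm _) _; rewrite normrM s1 mul1r.
  (* Young's inequality with weight [L * c] replaces Cauchy-Schwarz: by the Lipschitz bound both of
     its terms are then at most [L * c * sqn h]. *)
  have Lc : 0 < L * c by rewrite mulr_gt0.
  have dxE : x + c *: h - x = c *: h by rewrite addrC addKr.
  have := dotm_young _ (grad f (x + c *: h) - grad f x) h Lc.
  have := sqn_grad_lipschitz (x + c *: h) x.
  rewrite dxE sqnZ -(ler_pM2l (x := (L * c)^-1)) ?invr_gt0//.
  have -> : (L * c)^-1 * (L ^+ 2 * (c ^+ 2 * sqn h)) = L * c * sqn h.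
    by field; rewrite !gt_eqF.
  move: (_ * sqn (_ - _)) `|_| => u v; lra.
rewrite -[dk c]mulr1 -[X in dk c * X]subr0 -kE /k scale1r scale0r addr0; lra.
Qed.

(** Compare the convexity inequality at weight [t] with the descent lemma for the step
    [t *: (y - x)], divide by [t], and let [t] tend to 0. *)
Lemma strongly_convex_grad x y :
  f x + dotm (grad f x) (y - x) + mu / 2 * sqn (y - x) <= f y.
Proof.
set N := sqn (y - x); set a := dotm _ _.
have key (t : R) : 0 < t < 1 -> f x + a + mu / 2 * N - f y <= t * ((L + mu) / 2 * N).
  move=> /andP[t0 t1].
  have t01 : 0 <= t <= 1 by rewrite !ltW.
  have := f_cvx y x t t01; rewrite -/N.
  have := descent_lemma x (t *: (y - x)).
  rewrite dotmZr -/a sqnZ -/N ler_norml => /andP[+ _].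
  have -> : t *: y + (1 - t) *: x = x + t *: (y - x).
    by rewrite scalerBl scale1r scalerBr addrCA addrA addrAC.
  move=> h1 h2; rewrite -(ler_pM2l t0).
  lra.
rewrite -/a leNgt; apply/negP => fy.
(* The limit is made explicit: were the gap [c] positive, [key] at [t = c / D] would force
   [D <= (L + mu) / 2 * N], while [D] is chosen larger than that and than [c]. *)
pose c := f x + a + mu / 2 * N - f y.
have c0 : 0 < c by rewrite subr_gt0.
pose D := `|(L + mu) / 2 * N| + c + 1.
have D0 : 0 < D by rewrite /D; have := normr_ge0 ((L + mu) / 2 * N); lra.
have t01 : 0 < c / D < 1.
  by rewrite divr_gt0//= ltr_pdivrMr// mul1r /D; have := normr_ge0 ((L + mu) / 2 * N); lra.
have := key _ t01; rewrite -/c mulrAC ler_pdivlMr// ler_pM2l//.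
by rewrite /D; have := ler_norm ((L + mu) / 2 * N); lra.
Qed.

(** With [g] the gradient difference, evaluate [f] at [z = y - L^-1 *: g]: convexity at [x] bounds
    [f z] from below, the descent lemma at [y] bounds it from above. *)
Lemma cocoercive x y :
  0 <= mu ->
  sqn (grad f y - grad f x) <= 2 * L * (f y - f x - dotm (grad f x) (y - x)).
Proof.
have arith (p q r s t u v w : R) : v + (s - q) + w <= u -> u - t - - p <= r / 2 ->
  0 <= w -> r = p - q -> r <= 2 * (t - v - s) by lra.
move=> mu0; set g := grad f y - grad f x.
pose z := y - L^-1 *: g.
have h1 := strongly_convex_grad x z.
have := descent_lemma y (- (L^-1 *: g)); rewrite -/z sqnN sqnZ => /ler_normlP[_ h2].
have h3 : 0 <= mu / 2 * sqn (z - x) by rewrite mulr_ge0 ?sqn_ge0// divr_ge0.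
have E1 : dotm (grad f x) (z - x) = dotm (grad f x) (y - x) - L^-1 * dotm (grad f x) g.
  by rewrite -dotmZr -dotmBr /z addrAC.
have E2 : L^-1 * sqn g = L^-1 * dotm (grad f y) g - L^-1 * dotm (grad f x) g.
  by rewrite sqnE {1}/g dotmBl mulrBr.
have E3 : L / 2 * (L^-1 ^+ 2 * sqn g) = L^-1 * sqn g / 2.
  by field; rewrite gt_eqF.
rewrite E1 in h1; rewrite E3 dotmNr dotmZr in h2.
rewrite -mulrA mulrCA mulrC -ler_pdivrMr// mulrC.
exact: (arith _ _ _ _ _ _ _ _ h1 h2 h3 E2).
Qed.
End SmoothConvex.

(** * Weighted variance *)

Section WeightedVariance.
Context {R : realType} {n d : nat}.
Variables (P : pred 'I_n) (w : 'I_n -> R).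
Hypothesis w_ge0 : forall i, P i -> 0 <= w i.
Implicit Types X Y H : 'M[R]_(n, d).

Definition wmean X : 'rV[R]_d :=
  (\sum_(i | P i) w i)^-1 *: \sum_(i | P i) w i *: row i X.

(** Common form of the two penalties: [psi j] has the clients of cluster [j] with weights [gamma],
    [phi] has all clients with weights [alpha (c i) * gamma i]. *)
Definition wvar X : R := 2^-1 * \sum_(i | P i) w i * sqn (row i X - wmean X).

Definition wvar_grad X : 'M[R]_(n, d) :=
  \matrix_i (if P i then w i *: (row i X - wmean X) else 0).

Lemma wmeanB X Y : wmean (X - Y) = wmean X - wmean Y.
Proof.
rewrite /wmean -scalerBr -sumrB; congr (_ *: _); apply: eq_bigr => i _.
by rewrite linearB scalerBr.
Qed.

Lemma wmeanD X Y : wmean (X + Y) = wmean X + wmean Y.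
Proof.
rewrite /wmean -scalerDr -big_split; congr (_ *: _); apply: eq_bigr => i _ /=.
by rewrite linearD scalerDr.
Qed.

Lemma wvar_gradB X Y : wvar_grad (X - Y) = wvar_grad X - wvar_grad Y.
Proof.
apply/row_matrixP => i; rewrite [RHS]linearB /= !rowK; case: (P i); last by rewrite subr0.
by rewrite wmeanB [row i (X - Y)]linearB -(scalerBr (w i)) /= !opprD !opprK addrACA.
Qed.

(** If the total weight is 0, nonnegativity makes every weight 0, so the identity survives the
    convention for the inverse of 0. *)
Lemma wsum_wmean X :
  \sum_(i | P i) w i *: row i X = (\sum_(i | P i) w i) *: wmean X.
Proof.
have [W0|W0] := eqVneq (\sum_(i | P i) w i) 0; last by rewrite scalerA divff// scale1r.
rewrite W0 scale0r big1// => i Pi.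
by rewrite (psumr_eq0P w_ge0 W0)// scale0r.
Qed.

Lemma wsum_centered X : \sum_(i | P i) w i *: (row i X - wmean X) = 0.
Proof.
under eq_bigr do rewrite scalerBr.
by rewrite sumrB wsum_wmean -scaler_suml subrr.
Qed.

(** Subtracting [wmean H] costs nothing because the centered rows of [X] have weighted sum 0; the
    right side is a weighted covariance. *)
Lemma dotm_wvar_grad X H : dotm (wvar_grad X) H =
  \sum_(i | P i) w i * dotm (row i X - wmean X) (row i H - wmean H).
Proof.
rewrite dotm_row; under [RHS]eq_bigr do rewrite dotmBr mulrBr -!dotmZl.
rewrite sumrB -dotm_suml wsum_centered dotm0l subr0 [RHS]big_mkcond.
by apply: eq_bigr => i _; rewrite rowK; case: ifP => // _; rewrite dotm0l.
Qed.

Lemma wvar_ge0 X : 0 <= wvar X.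
Proof.
rewrite mulr_ge0 ?invr_ge0//; apply: sumr_ge0 => i Pi.
by rewrite mulr_ge0 ?sqn_ge0 ?w_ge0.
Qed.

(** A quadratic form has an exact second-order expansion, so its Bregman divergence is [wvar H],
    whatever [X] is. *)
Lemma wvarD X H : wvar (X + H) = wvar X + dotm (wvar_grad X) H + wvar H.
Proof.
rewrite dotm_wvar_grad -(mulKf (_ : 2 != 0 :> R) (\sum_(i | _) _ * dotm _ _))//.
rewrite -!mulrDr; congr (_ * _); rewrite mulr_sumr -!big_split; apply: eq_bigr => i _ /=.
rewrite wmeanD [row i (X + H)]linearD /= opprD addrACA (sqnD (row i X - wmean X)); ring.
Qed.

(** Variance is second moment minus the squared mean. The constant is crude: only some quadratic
    bound is wanted, for [grad_eq] and [bregman_le]. *)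
Lemma wvar_le X : wvar X <= (2^-1 * \sum_(i | P i) w i) * sqn X.
Proof.
rewrite -mulrA ler_wpM2l ?invr_ge0// mulr_suml.
apply: (@le_trans _ _ (\sum_(i | P i) w i * sqn (row i X))).
  have -> : \sum_(i | P i) w i * sqn (row i X - wmean X) =
     \sum_(i | P i) w i * sqn (row i X) - (\sum_(i | P i) w i) * sqn (wmean X).
    transitivity (\sum_(i | P i) (w i * sqn (row i X) - w i * sqn (wmean X)
       - 2 * dotm (w i *: (row i X - wmean X)) (wmean X))).
      by apply: eq_bigr => i _; rewrite sqnD sqnN dotmZl dotmBl dotmNr (sqnE (wmean X)); ring.
    by rewrite sumrB -mulr_sumr -dotm_suml wsum_centered dotm0l mulr0 subr0 sumrB -mulr_suml.
  by rewrite gerBl mulr_ge0 ?sqn_ge0 ?sumr_ge0.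
apply: ler_sum => i Pi; rewrite ler_wpM2l ?w_ge0// [leRHS]sqn_row (bigD1 i)//=.
by rewrite lerDl sumr_ge0// => *; rewrite sqn_ge0.
Qed.

Lemma grad_wvar X : grad wvar X = wvar_grad X.
Proof.
apply: (grad_eq _ _ _ (2^-1 * \sum_(i | P i) w i)) => H.
by rewrite wvarD -addrA -opprD [_ + wvar H]addrC addrK ger0_norm ?wvar_ge0 ?wvar_le.
Qed.

(** Of the two factors [w i] in the squared gradient, one is absorbed with [e] into [M] and the
    other rebuilds [wvar]. Later [e] is a noise coefficient and [M] is [calL]. *)
Lemma sqn_wvar_grad_le (e M : R) X : (forall i, P i -> e * w i <= M) ->
  e * sqn (wvar_grad X) <= 2 * M * wvar X.
Proof.
move=> wM; rewrite [2 * M]mulrC -mulrA mulVKf// sqn_row !mulr_sumr [leRHS]big_mkcond.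
apply: ler_sum => i _; rewrite rowK; case: ifP => [Pi|_]; last by rewrite sqn0 mulr0.
rewrite sqnZ expr2 -mulrA mulrA ler_wpM2r ?wM//.
by rewrite mulr_ge0 ?sqn_ge0 ?w_ge0.
Qed.

End WeightedVariance.

(** * Expectation over the draws *)

(** Attach [F] to the factor of index [j] and exchange product and sum; every other factor sums to
    1. *)
Lemma sum_bernoulli_marginal {R : realType} {k : nat} (p : 'I_k -> R) (j : 'I_k)
    (F : bool -> R) :
  \sum_(v : {ffun 'I_k -> bool}) (\prod_i (if v i then p i else 1 - p i)) * F (v j)
    = p j * F true + (1 - p j) * F false.
Proof.
pose q i (b : bool) := (if b then p i else 1 - p i) * (if i == j then F b else 1).
transitivity (\prod_i \sum_b q i b).
  rewrite bigA_distr_bigA; apply: eq_bigr => v _; rewrite big_split /=; congr (_ * _).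
  by rewrite -big_mkcond big_pred1_eq.
rewrite (bigD1 j)//= [X in _ * X]big1 => [|i /negPf ij]; last first.
  by rewrite big_bool /q ij /= !mulr1 addrC subrK.
by rewrite mulr1 big_bool /q eqxx.
Qed.

(** Row [i] of the oracle depends on the draw only through its first component and the coordinate of
    cluster [c i], so this marginal suffices. *)
Lemma sum_Pdraw_marginal {R : realType} {k : nat} (p0 : R) (p : 'I_k -> R) (j : 'I_k)
    (F : bool -> bool -> R) :
  \sum_w Pdraw p0 p w * F w.1 (w.2 j)
    = p0 * (p j * F true true + (1 - p j) * F true false)
      + (1 - p0) * (p j * F false true + (1 - p j) * F false false).
Proof.
rewrite -(pair_bigA _ (fun b v => Pdraw p0 p (b, v) * F b (v j)))/= big_bool /Pdraw/=.
by congr (_ + _); rewrite -sum_bernoulli_marginal mulr_sumr;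
  apply: eq_bigr => v _; rewrite mulrA.
Qed.

Lemma sum_Pdraw {R : realType} {k : nat} (p0 : R) (p : 'I_k -> R) :
  \sum_w Pdraw p0 p w = 1.
Proof.
rewrite -(pair_bigA _ (fun b v => Pdraw p0 p (b, v)))/= big_bool /Pdraw/=.
rewrite -!mulr_sumr -(bigA_distr_bigA (fun i (b : bool) => if b then p i else 1 - p i)).
by rewrite big1 => [|i _]; rewrite ?big_bool /= addrC ?subrK//; ring.
Qed.

Lemma Pdraw_ge0 {R : realType} {k : nat} (p0 : R) (p : 'I_k -> R) w :
  0 <= p0 <= 1 -> (forall j, 0 <= p j <= 1) -> 0 <= Pdraw p0 p w.
Proof.
move=> /andP[? ?] p01; rewrite mulr_ge0 ?prodr_ge0//.
  by case: ifP; rewrite ?subr_ge0.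
by move=> j _; have /andP[? ?] := p01 j; case: ifP; rewrite ?subr_ge0.
Qed.

(** * Histories of draws, and conditioning on all but the last one *)

Section FfunRcons.
Context {T : finType} {t : nat}.

Definition ffun_rcons (w : {ffun 'I_t -> T}) (x : T) : {ffun 'I_t.+1 -> T} :=
  [ffun s => oapp w x (unlift ord_max s)].

Lemma ffun_rcons_max w x : ffun_rcons w x ord_max = x.
Proof. by rewrite ffunE unlift_none. Qed.

Lemma ffun_rcons_widen w x (s : 'I_t) : ffun_rcons w x (widen_ord (leqnSn t) s) = w s.
Proof.
have -> : widen_ord (leqnSn t) s = lift ord_max s.
  by apply/val_inj; rewrite /= /bump leqNgt ltn_ord.
by rewrite ffunE liftK.
Qed.

(** Independence of the last draw: the inner sum is the conditional expectation given the first [t]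
    draws. *)
Lemma sum_prod_ffun_rcons {R : realType} (P : T -> R) (F : {ffun 'I_t.+1 -> T} -> R) :
  \sum_(w : {ffun 'I_t.+1 -> T}) (\prod_s P (w s)) * F w
    = \sum_(w : {ffun 'I_t -> T}) (\prod_s P (w s)) * \sum_x P x * F (ffun_rcons w x).
Proof.
under [RHS]eq_bigr do rewrite mulr_sumr.
rewrite pair_bigA/= (reindex (fun u : {ffun 'I_t -> T} * T => ffun_rcons u.1 u.2))/=; last first.
  exists (fun w : {ffun 'I_t.+1 -> T} =>
    ([ffun s => w (widen_ord (leqnSn t) s)], w ord_max)) => [[w x]|w] _.
    by congr (_, _); rewrite ?ffun_rcons_max//; apply/ffunP => s; rewrite ffunE ffun_rcons_widen.
  apply/ffunP => s; rewrite ffunE; case: unliftP => [s'|] -> //=.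
  by rewrite ffunE; congr (w _); apply/val_inj; rewrite /= /bump leqNgt ltn_ord.
apply: eq_bigr => -[w x] _; rewrite big_ord_recr/= ffun_rcons_max -mulrA; congr (_ * _).
by apply: eq_bigr => s _; rewrite ffun_rcons_widen.
Qed.

End FfunRcons.

Section Iterates.
Context {R : realType} {n d k : nat}.
Variables (c : 'I_n -> 'I_k) (gamma : 'I_n -> R) (alpha : 'I_k -> R).
Variables (f : 'I_n -> 'rV[R]_d -> R) (p0 : R) (p tau : 'I_k -> R) (eta : R).
Variables (Th0 That : 'M[R]_(n, d)).

Local Notation iterate := (iterate c gamma alpha f p0 p tau eta Th0).
Local Notation Gor := (Gor c gamma alpha f p0 p tau).
Local Notation expected_sqdist := (expected_sqdist c gamma alpha f p0 p tau eta Th0).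

(** The iterate at time [t] reads only the draws before [t], so the default draws padding [ext_seq]
    have no effect. *)
Lemma iterate_ext om om' t : (forall s, (s < t)%N -> om s = om' s) ->
  iterate om t = iterate om' t.
Proof.
elim: t => [//|t IH] omE /=.
have IHt : iterate om t = iterate om' t by apply: IH => s st; apply: omE; exact: leqW.
by rewrite IHt (omE t (ltnSn t)).
Qed.

Lemma iterate_rcons t (w : {ffun 'I_t -> draw}) (x : draw (k := k)) :
  iterate (ext_seq (ffun_rcons w x)) t.+1 =
  iterate (ext_seq w) t - eta *: Gor (iterate (ext_seq w) t) x.
Proof.
have lastE : ext_seq (ffun_rcons w x) t = x.
  rewrite /ext_seq insubT => // tt; rewrite -[RHS](ffun_rcons_max w x).
  by congr (ffun_rcons _ _ _); exact/val_inj.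
have initE s : (s < t)%N -> ext_seq (ffun_rcons w x) s = ext_seq w s.
  move=> st; rewrite /ext_seq !insubT => [|?]; first exact: leqW.
  rewrite -(ffun_rcons_widen w x).
  by congr (ffun_rcons _ _ _); exact/val_inj.
by rewrite /= lastE (iterate_ext _ _ _ initE).
Qed.

Lemma expected_sqdist0 : expected_sqdist 0 That = sqn (Th0 - That).
Proof.
rewrite /expected_sqdist (big_pred1 [ffun=> default_draw]) => [|w].
  by rewrite big_ord0 mul1r.
by apply/esym/eqP/ffunP => -[].
Qed.

Lemma expected_sqdist_step (rho e : R) t :
  (forall w, 0 <= Pdraw p0 p w) ->
  (forall Th, \sum_x Pdraw p0 p x * sqn (Th - eta *: Gor Th x - That)
     <= rho * sqn (Th - That) + e) ->
  expected_sqdist t.+1 That <= rho * expected_sqdist t That + e.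
Proof.
move=> P0 step; have sumP1 : \sum_(w : {ffun 'I_t -> draw}) \prod_s Pdraw p0 p (w s) = 1.
  by rewrite -(bigA_distr_bigA (fun=> Pdraw p0 p)) big1// => s _; exact: sum_Pdraw.
(* Spreading [e] over the histories, of total mass 1, reduces the claim to one inequality per
   history. *)
have -> : e = \sum_(w : {ffun 'I_t -> draw}) (\prod_s Pdraw p0 p (w s)) * e.
  by rewrite -mulr_suml sumP1 mul1r.
rewrite /expected_sqdist sum_prod_ffun_rcons mulr_sumr -big_split.
apply: ler_sum => w _; rewrite [leRHS]/= mulrCA -mulrDr ler_wpM2l ?prodr_ge0//.
under eq_bigr do rewrite iterate_rcons.
exact: step.
Qed.

End Iterates.

(** * One step of the oracle *)

Lemma lin_term_ge0 {R : realType} (a C : R) :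
  (forall t, 0 < t <= 1 -> 0 <= t * a + t ^+ 2 * C) -> 0 <= a.
Proof.
move=> h; rewrite leNgt; apply/negP => a0.
(* If [a < 0], the choice [t = - a / D] lies in (0, 1] and gives [a + t * |C| = 2 * a * t < 0]. *)
pose D := `|C| - 2 * a.
have C0 := ler_norm C; have C1 := normr_ge0 C.
have D0 : 0 < D by rewrite /D; lra.
have t01 : 0 < - a / D <= 1.
  by rewrite divr_gt0 ?oppr_gt0//= ler_pdivrMr// mul1r /D; lra.
have /andP[t0 _] := t01.
have := h _ t01; rewrite expr2 -mulrA -mulrDr pmulr_rge0//.
have : - a / D * C <= - a / D * D.
  by rewrite ler_wpM2l ?(ltW t0)// /D; lra.
rewrite divfK ?gt_eqF//.
have : - a / D * C <= - a / D * `|C| by rewrite ler_wpM2l ?(ltW t0).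
have : - a / D * `|C| = - a - (- a / D) * (- 2 * a).
  by rewrite /D; field; rewrite -/D gt_eqF.
have : 0 < - a / D * (- 2 * a) by rewrite mulr_gt0//; lra.
move: (- a / D * C) (- a / D * `|C|) (- a / D * (- 2 * a)) => u v w; lra.
Qed.

(** Here [b] and [b'] are the Bregman divergences from the minimizer to the current point and back,
    [g] and [g'] the pairings of the displacement with the two gradients. Adding the two expansions
    gives [g = g' + b + b' >= b + mu / 2 * S], and the noise term [4 * e ^+ 2 * l * b] is at most
    [2 * e * b], hence cancels. *)
Lemma contraction_arith {R : realType} (mu e l N s b b' g g' S FX FT : R) :
  0 < e -> 2 * e * l <= 1 ->
  N <= 4 * l * b + 2 * s -> FX = FT + g' + b -> FT = FX - g + b' -> 0 <= g' ->
  mu / 2 * S <= b' -> 0 <= b ->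
  S - 2 * e * g + e ^+ 2 * N <= (1 - e * mu) * S + 2 * e ^+ 2 * s.
Proof.
move=> e0 el hN hX hT hg' hb' hb.
have hN' : e ^+ 2 * N <= e ^+ 2 * (4 * l * b + 2 * s) by rewrite ler_wpM2l ?sqr_ge0.
have hg : 2 * e * (b + mu / 2 * S) <= 2 * e * g.
  by rewrite ler_pM2l ?mulr_gt0//; lra.
have hl : 2 * e * b * (2 * e * l) <= 2 * e * b * 1.
  by rewrite ler_wpM2l// mulr_ge0// mulr_ge0// ltW.
clear - hN' hg hl; lra.
Qed.

Section RowStep.
Context {R : realType} {d : nat}.
Variables (al p0 pj tau : R).
Hypotheses (p001 : 0 < p0 < 1) (pj01 : 0 < pj < 1).
Hypothesis tauE : tau = p0 / (p0 + 2 * (1 - p0) * pj).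

Definition row_noise (a b g : 'rV[R]_d) : R :=
  2 / p0 * sqn a + 2 * (1 - al) ^+ 2 / (p0 + 2 * (1 - p0) * pj) * sqn b
  + (1 - p0)^-1 * ((1 - pj)^-1 * sqn g).

(* The value of [tau] makes
   [2 tau^2 / p0 + (1 - tau)^2 / ((1 - p0) pj) = 2 / (p0 + 2 (1 - p0) pj)]. *)
Lemma row_step (eta : R) (x a b g u1 u2 u3 : 'rV[R]_d) :
  u1 = p0^-1 *: a + (tau * (1 - al) / p0) *: b ->
  u2 = ((1 - tau) * (1 - al) / ((1 - p0) * pj)) *: b ->
  u3 = ((1 - p0) * (1 - pj))^-1 *: g ->
  p0 * (pj * sqn (x - eta *: u1) + (1 - pj) * sqn (x - eta *: u1))
    + (1 - p0) * (pj * sqn (x - eta *: u2) + (1 - pj) * sqn (x - eta *: u3))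
  <= sqn x - 2 * eta * dotm (a + (1 - al) *: b + g) x + eta ^+ 2 * row_noise a b g.
Proof.
move=> u1E u2E u3E; have /andP[p0_gt0 p0_lt1] := p001; have /andP[pj_gt0 pj_lt1] := pj01.
have q0_gt0 : 0 < 1 - p0 by rewrite subr_gt0.
have qj_gt0 : 0 < 1 - pj by rewrite subr_gt0.
have D_gt0 : 0 < p0 + 2 * (1 - p0) * pj by rewrite addr_gt0// !mulr_gt0.
have expand u : sqn (x - eta *: u) = sqn x - 2 * eta * dotm u x + eta ^+ 2 * sqn u.
  by rewrite sqnD sqnN sqnZ dotmNr dotmZr (dotmC x); ring.
have u1x : dotm u1 x = p0^-1 * dotm a x + tau * (1 - al) / p0 * dotm b x.
  by rewrite u1E !dotmE.
(* Only the branch with [xi_0 = 1] mixes two gradients. This splitting is the only loss: its slack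
   is exactly the slack of the goal. *)
have u1_le := sqnD_le (p0^-1 *: a) ((tau * (1 - al) / p0) *: b).
have := ler_wpM2l (sqr_ge0 eta) (ler_wpM2l (ltW p0_gt0) u1_le).
rewrite -u1E !expand u2E u3E u1x !sqnZ !dotmE /row_noise tauE.
move: (sqn u1) (sqn a) (sqn b) (sqn g) (sqn x) (dotm a x) (dotm b x) (dotm g x).
move=> su sa sb sg sx da db dg su_le.
rewrite -subr_ge0 in su_le; rewrite -subr_ge0.
apply: le_trans su_le _; rewrite le_eqVlt; apply/orP; left; apply/eqP.
by field; rewrite !gt_eqF.
Qed.

Lemma row_noiseB_le (a b g a' b' g' : 'rV[R]_d) :
  row_noise a b g <= 2 * row_noise (a - a') (b - b') (g - g') + 2 * row_noise a' b' g'.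
Proof.
have /andP[p0_gt0 p0_lt1] := p001; have /andP[pj_gt0 pj_lt1] := pj01.
have q0_gt0 : 0 < 1 - p0 by rewrite subr_gt0.
have qj_gt0 : 0 < 1 - pj by rewrite subr_gt0.
have D_gt0 : 0 < p0 + 2 * (1 - p0) * pj by rewrite addr_gt0// !mulr_gt0.
have split_le (e : R) (u u' : 'rV[R]_d) : 0 <= e ->
    e * sqn u <= 2 * (e * sqn (u - u')) + 2 * (e * sqn u').
  move=> e0; rewrite !(mulrCA 2) -mulrDr ler_wpM2l//.
  by rewrite -[u in leLHS](subrK u') sqnD_le.
have c1 : 0 <= 2 / p0 by rewrite divr_ge0// ltW.
have c2 : 0 <= 2 * (1 - al) ^+ 2 / (p0 + 2 * (1 - p0) * pj).
  by apply: divr_ge0; [rewrite mulr_ge0 ?sqr_ge0|exact: ltW].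
have c3 : 0 <= (1 - p0)^-1 * (1 - pj)^-1 by rewrite mulr_ge0// invr_ge0 ltW.
have := lerD (lerD (split_le _ a a' c1) (split_le _ b b' c2)) (split_le _ g g' c3).
rewrite /row_noise !(mulrA (1 - p0)^-1).
set A := _ * sqn (a - a'); set A' := _ * sqn a'.
set B := _ * sqn (b - b'); set B' := _ * sqn b'.
set G := _ * sqn (g - g'); set G' := _ * sqn g'.
move/le_trans; apply.
rewrite le_eqVlt; apply/orP; left; apply/eqP; ring.
Qed.

End RowStep.

(** * Expected smoothness and the one-step contraction *)

Section ExpectedSmoothness.
Context {R : realType} {n d k : nat}.
Variables (c : 'I_n -> 'I_k) (gamma : 'I_n -> R) (alpha : 'I_k -> R).
Variables (f : 'I_n -> 'rV[R]_d -> R) (mu L p0 : R) (p tau : 'I_k -> R) (eta : R).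
Hypotheses (gamma_gt0 : forall i, 0 < gamma i) (alpha01 : forall j, 0 <= alpha j <= 1).
Hypotheses (mu_gt0 : 0 < mu) (mu_le_L : mu <= L).
Hypothesis f_diff : forall i (x : 'rV[R]_d), differentiable (f i) x.
Hypothesis f_cvx : forall i, strongly_convex mu (f i).
Hypothesis f_smooth : forall i, smooth_L L (f i).
Hypotheses (p001 : 0 < p0 < 1) (p01 : forall j, 0 < p j < 1).
Hypothesis tauE : forall j, tau j = p0 / (p0 + 2 * (1 - p0) * p j).
Implicit Types X H : 'M[R]_(n, d).

Local Notation weight := (fun i : 'I_n => alpha (c i) * gamma i).
Local Notation phi := (phi c gamma alpha).
Local Notation psi := (psi c gamma).
Local Notation Fobj := (Fobj c gamma alpha f).
Local Notation Fj := (Fj c f).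
Local Notation calL := (calL c gamma alpha p0 p L).
Local Notation sigma2 := (sigma2 c gamma alpha f p0 p).
Local Notation Gor := (Gor c gamma alpha f p0 p tau).

Definition grad_phi X := wvar_grad xpredT weight X.
Definition grad_psi (j : 'I_k) X := wvar_grad (fun i => c i == j) gamma X.
Definition grad_local X : 'M[R]_(n, d) := \matrix_i grad (f i) (row i X).
Definition grad_obj X :=
  grad_local X + \sum_j (1 - alpha j) *: grad_psi j X + grad_phi X.

Let L_gt0 : 0 < L := lt_le_trans mu_gt0 mu_le_L.

Lemma weight_ge0 i : 0 <= weight i.
Proof. by have /andP[a0 _] := alpha01 (c i); rewrite mulr_ge0// ltW. Qed.

Lemma sum_clusters (F : 'I_n -> R) : \sum_i F i = \sum_j \sum_(i | c i == j) F i.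
Proof. by rewrite (partition_big c xpredT). Qed.

Lemma phiE X : phi X = wvar xpredT weight X.
Proof.
rewrite /phi /wvar; congr (_ * _); rewrite [RHS]sum_clusters.
apply: eq_bigr => j _; rewrite mulr_sumr; apply: eq_bigr => i /eqP <-.
by rewrite mulrA.
Qed.

Lemma row_grad_psi j i X : row i (grad_psi j X) =
  if c i == j then gamma i *: (row i X - bar_j c gamma j X) else 0.
Proof. by rewrite rowK. Qed.

Lemma row_grad_obj i X : row i (grad_obj X) =
  row i (grad_phi X) + (1 - alpha (c i)) *: row i (grad_psi (c i) X)
    + row i (grad_local X).
Proof.
rewrite /grad_obj [LHS]linearD /= [row i (_ + \sum_(j < k) _)]linearD /=.
rewrite linear_sum (bigD1 (c i))//= big1 ?addr0 => [|j ij].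
  by rewrite linearZ addrC addrA addrAC.
by rewrite linearZ /= row_grad_psi eq_sym (negPf ij) scaler0.
Qed.

(** Bregman divergence of [Fobj] between [X + H] and [X]; the quadratic penalties contribute their
    own value at [H]. *)
Definition bregman X H : R :=
  \sum_i (f i (row i X + row i H) - f i (row i X) - dotm (grad (f i) (row i X)) (row i H))
  + \sum_j (1 - alpha j) * psi j H + phi H.

Lemma Fobj_expand X H :
  Fobj (X + H) = Fobj X + dotm (grad_obj X) H + bregman X H.
Proof.
rewrite /Fobj !phiE wvarD => [|i _]; last exact: weight_ge0.
rewrite /bregman phiE.
have -> : \sum_j (1 - alpha j) * psi j (X + H) =
    \sum_j (1 - alpha j) * psi j X
    + dotm (\sum_j (1 - alpha j) *: grad_psi j X) H
    + \sum_j (1 - alpha j) * psi j H.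
  rewrite dotm_suml -!big_split; apply: eq_bigr => j _ /=.
  rewrite dotmZl -!mulrDr; congr (_ * _).
  by apply: wvarD => i _; exact: ltW.
rewrite -!sum_clusters.
have -> : \sum_i f i (row i (X + H)) = \sum_i f i (row i X) + dotm (grad_local X) H +
   \sum_i (f i (row i X + row i H) - f i (row i X) - dotm (grad (f i) (row i X)) (row i H)).
  rewrite dotm_row -!big_split; apply: eq_bigr => i _ /=.
  by rewrite rowK [row i (X + H)]linearD /=; ring.
rewrite /grad_obj !dotmDl -/(grad_phi X).
by ring.
Qed.

Lemma psi_ge0 j X : 0 <= psi j X.
Proof. by apply: wvar_ge0 => i _; exact: ltW. Qed.

Lemma phi_ge0 X : 0 <= phi X.
Proof. by rewrite phiE; apply: wvar_ge0 => i _; exact: weight_ge0. Qed.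

Lemma bregman_ge X H : mu / 2 * sqn H <= bregman X H.
Proof.
rewrite /bregman -addrA -[leLHS]addr0 lerD//; last first.
  rewrite addr_ge0 ?phi_ge0// sumr_ge0// => j _.
  by have /andP[_ a1] := alpha01 j; rewrite mulr_ge0 ?psi_ge0 ?subr_ge0.
rewrite sqn_row mulr_sumr; apply: ler_sum => i _.
have := strongly_convex_grad _ _ _ L_gt0 (f_diff i) (f_smooth i) (f_cvx i)
  (row i X) (row i X + row i H).
by rewrite [_ + row i H]addrC addrK; lra.
Qed.

(** Makes the second-order term of [Fobj] along [t *: H] a multiple of [t ^+ 2], as [lin_term_ge0]
    requires. *)
Lemma bregman_le X : exists C, forall H, bregman X H <= C * sqn H.
Proof.
exists (L / 2 + \sum_j (1 - alpha j) * (2^-1 * \sum_(i | c i == j) gamma i)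
   + 2^-1 * \sum_i weight i) => H.
rewrite /bregman !mulrDl; apply: lerD; last first.
  by rewrite phiE; apply: wvar_le => i _; exact: weight_ge0.
apply: lerD; last first.
  rewrite mulr_suml; apply: ler_sum => j _; rewrite -mulrA ler_wpM2l//.
    by have /andP[_ a1] := alpha01 j; rewrite subr_ge0.
  by apply: wvar_le => i _; exact: ltW.
rewrite sqn_row mulr_sumr; apply: ler_sum => i _.
exact: le_trans (ler_norm _) (descent_lemma _ _ L_gt0 (f_diff i) (f_smooth i) _ _).
Qed.

Lemma minimizer_first_order X H :
  (forall Y, Fobj X <= Fobj Y) -> 0 <= dotm (grad_obj X) H.
Proof.
move=> Xmin; have [C CH] := bregman_le X.
apply: (lin_term_ge0 _ (C * sqn H)) => t _.
have := Xmin (X + t *: H); have := CH (t *: H).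
by rewrite Fobj_expand dotmZr sqnZ mulrCA; lra.
Qed.

Lemma row_grad_localB i X H : row i (grad_local (X + H) - grad_local X) =
  grad (f i) (row i X + row i H) - grad (f i) (row i X).
Proof.
transitivity (row i (grad_local (X + H)) - row i (grad_local X)); first exact: linearB.
have glE Y : row i (grad_local Y) = grad (f i) (row i Y) by exact: rowK.
have rowD : row i (X + H) = row i X + row i H by exact: linearD.
by rewrite -rowD -!glE.
Qed.

Lemma le_calL_phi i : 2 / p0 * weight i <= calL.
Proof.
have /andP[p0_gt0 _] := p001.
rewrite /calL !le_max; apply/orP; left; apply/orP; left.
by rewrite ler_wpM2l ?divr_ge0 ?(ltW p0_gt0)//; exact: (le_bigmax _ weight).
Qed.

Lemma psi_den_gt0 j : 0 < p0 + 2 * (1 - p0) * p j.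
Proof.
have /andP[p0_gt0 p0_lt1] := p001; have /andP[pj_gt0 _] := p01 j.
by rewrite addr_gt0// !mulr_gt0// subr_gt0.
Qed.

Lemma le_calL_psi i :
  2 * (1 - alpha (c i)) / (p0 + 2 * (1 - p0) * p (c i)) * gamma i <= calL.
Proof.
rewrite /calL !le_max; apply/orP; left; apply/orP; right.
apply: le_trans (le_bigmax _ _ (c i)); rewrite mulrAC.
have /andP[_ a1] := alpha01 (c i).
rewrite ler_wpM2r ?invr_ge0 ?(ltW (psi_den_gt0 _))// ler_wpM2l ?mulr_ge0 ?subr_ge0//.
exact: (le_bigmax_cond _ (P := fun i' => c i' == c i) gamma).
Qed.

Lemma le_calL_local j : L / (1 - p0) * (1 - p j)^-1 <= calL.
Proof.
have /andP[_ p0_lt1] := p001.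
rewrite /calL !le_max; apply/orP; right.
rewrite ler_wpM2l ?divr_ge0 ?subr_ge0 ?(ltW L_gt0) ?(ltW p0_lt1)//.
exact: (le_bigmax _ (fun j => (1 - p j)^-1)).
Qed.

(** [1 - p0] and [1 - p j] lie in (0, 1). The argument [j] makes the maximum over clusters range
    over something. The bound yields [0 < calL] and [eta * mu <= 1]. *)
Lemma L_le_calL (j : 'I_k) : L <= calL.
Proof.
apply: le_trans (le_calL_local j).
have /andP[p0_gt0 p0_lt1] := p001; have /andP[pj_gt0 pj_lt1] := p01 j.
rewrite -mulrA ler_peMr ?(ltW L_gt0)// -invfM invf_ge1 ?mulr_gt0 ?subr_gt0//.
by rewrite mulr_ile1 ?subr_ge0 ?ltW// ltrBlDr ltrDl.
Qed.

Definition row_noise_at (i : 'I_n) : 'rV[R]_d -> 'rV[R]_d -> 'rV[R]_d -> R :=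
  row_noise (alpha (c i)) p0 (p (c i)).

Definition psi_coef (j : 'I_k) : R := 2 * (1 - alpha j) ^+ 2 / (p0 + 2 * (1 - p0) * p j).

(** Since [B j] lives on the rows of cluster [j], taking for each client the row of its own cluster
    recovers every full [sqn (B j)]. Applied to gradients and to gradient differences. *)
Lemma sum_row_noise (A : 'M[R]_(n, d)) (B : 'I_k -> 'M[R]_(n, d)) (G : 'M[R]_(n, d)) :
  (forall i j, c i != j -> row i (B j) = 0) ->
  \sum_i row_noise_at i (row i A) (row i (B (c i))) (row i G)
  = 2 / p0 * sqn A + \sum_j psi_coef j * sqn (B j)
    + (1 - p0)^-1 * \sum_i (1 - p (c i))^-1 * sqn (row i G).
Proof.
move=> B0; rewrite sqn_row !mulr_sumr.
have -> : \sum_j psi_coef j * sqn (B j) =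
    \sum_i psi_coef (c i) * sqn (row i (B (c i))).
  rewrite sum_clusters; apply: eq_bigr => j _.
  rewrite sqn_row mulr_sumr [RHS]big_mkcond; apply: eq_bigr => i _.
  by have [<-//|cij] := eqVneq (c i) j; rewrite B0// sqn0 mulr0.
by rewrite -!big_split.
Qed.

Definition noise X : R :=
  \sum_i row_noise_at i (row i (grad_phi X)) (row i (grad_psi (c i) X)) (row i (grad_local X)).

Lemma grad_Fj j X :
  grad (Fj j) X = \matrix_i (if c i == j then grad (f i) (row i X) else 0).
Proof.
apply: (grad_eq _ _ _ (L / 2)) => H.
rewrite dotm_row /Fj !(big_mkcond (fun i => c i == j)) -!sumrB.
apply: le_trans (ler_norm_sum _ _ _) _.
rewrite sqn_row mulr_sumr; apply: ler_sum => i _; rewrite rowK.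
case: ifP => _.
  by rewrite [row i (X + H)]linearD; exact: descent_lemma.
rewrite dotm0l !subr0 normr0 mulr_ge0 ?sqn_ge0//.
by rewrite divr_ge0// ltW.
Qed.

(** Here the explicit row formulas are identified with the differentials [grad] that define
    [sigma2]. *)
Lemma noise_sigma2 X : noise X = sigma2 X.
Proof.
rewrite /noise (sum_row_noise _ (fun j => grad_psi j X)) => [|i j /negPf cij].
  2: by rewrite row_grad_psi cij.
have -> : grad_phi X = grad phi X.
  have -> : phi = (fun Y : 'M[R]_(n, d) => wvar xpredT weight Y).
    by apply/funext => Y; exact: phiE.
  by rewrite grad_wvar// => i _; exact: weight_ge0.
congr (_ + _ + _ * _).
  apply: eq_bigr => j _; congr (_ * sqn _).
  by rewrite grad_wvar// => i _; exact: ltW.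
rewrite sum_clusters; apply: eq_bigr => j _.
rewrite grad_Fj sqn_row mulr_sumr [LHS]big_mkcond; apply: eq_bigr => i _.
by rewrite !rowK; case: eqP => [<-//|_]; rewrite sqn0 mulr0.
Qed.

Lemma oracle_step (X Y : 'M[R]_(n, d)) :
  \sum_w Pdraw p0 p w * sqn (X - eta *: Gor X w - Y)
  <= sqn (X - Y) - 2 * eta * dotm (grad_obj X) (X - Y) + eta ^+ 2 * noise X.
Proof.
under eq_bigr do rewrite sqn_row mulr_sumr.
rewrite exchange_big [sqn (X - Y)]sqn_row dotm_row !mulr_sumr -sumrB -big_split/=.
apply: ler_sum => i _.
set x := row i (X - Y).
pose u1 := (gamma i * alpha (c i) / p0) *: (row i X - bar c gamma alpha X)
  + (gamma i * tau (c i) * (1 - alpha (c i)) / p0) *: (row i X - bar_j c gamma (c i) X).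
pose u2 := (gamma i * (1 - tau (c i)) * (1 - alpha (c i)) / ((1 - p0) * p (c i))) *:
  (row i X - bar_j c gamma (c i) X).
pose u3 := ((1 - p0) * (1 - p (c i)))^-1 *: grad (f i) (row i X).
pose F b b' := sqn (x - eta *: (if b then u1 else if b' then u2 else u3)).
have FE w : sqn (row i (X - eta *: Gor X w - Y)) = F w.1 (w.2 (c i)).
  rewrite addrAC linearB linearZ /= rowK /F /Gi.
  by case: (w.1) => //; case: (w.2 _).
under eq_bigr do rewrite FE.
rewrite sum_Pdraw_marginal row_grad_obj.
apply: (row_step _ _ _ _ p001 (p01 (c i)) (tauE (c i))); rewrite ?rowK /= ?eqxx ?scalerA.
- by congr (_ *: _ + _ *: _); ring.
- by congr (_ *: _); ring.
- by [].
Qed.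

Lemma noiseD_le X H : noise (X + H) <= 4 * calL * bregman X H + 2 * sigma2 X.
Proof.
have /andP[p0_gt0 p0_lt1] := p001.
rewrite -noise_sigma2.
(* Splitting off the gradients at [X] costs a factor 2; each of the three blocks of [dnoise] is then
   at most [2 * calL] times its share of the Bregman divergence. *)
pose dnoise := \sum_i row_noise_at i (row i (grad_phi (X + H) - grad_phi X))
  (row i (grad_psi (c i) (X + H) - grad_psi (c i) X))
  (row i (grad_local (X + H) - grad_local X)).
have noise_le : noise (X + H) <= 2 * dnoise + 2 * noise X.
  rewrite !mulr_sumr -big_split; apply: ler_sum => i _ /=.
  rewrite ![row i (_ - _)]linearB.
  exact: (row_noiseB_le _ _ _ p001 (p01 (c i))).
suff dnoise_le : dnoise <= 2 * calL * bregman X H.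
  apply: le_trans noise_le _; rewrite lerD2r.
  have -> : 4 = 2 * 2 :> R by rewrite -natrM.
  by rewrite -!mulrA ler_pM2l// mulrA.
rewrite /dnoise (sum_row_noise _ (fun j => grad_psi j (X + H) - grad_psi j X)); last first.
  by move=> i j /negPf cij; rewrite linearB /= !row_grad_psi cij subr0.
have XH : X + H - X = H by rewrite addrC addKr.
rewrite -wvar_gradB XH.
under eq_bigr do rewrite -wvar_gradB XH.
rewrite /bregman [leLHS]addrC [X in _ + X <= _]addrC addrA !mulrDr; apply: lerD; last first.
  by rewrite phiE sqn_wvar_grad_le// => *; rewrite ?weight_ge0 ?le_calL_phi.
apply: lerD; last first.
  rewrite mulr_sumr; apply: ler_sum => j _.
  (* One factor [1 - alpha j] stays as the weight of [psi j] in [bregman]; the other belongs to the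
     term of [calL]. *)
  have -> : psi_coef j = (1 - alpha j) * (2 * (1 - alpha j) / (p0 + 2 * (1 - p0) * p j)).
    by rewrite /psi_coef; ring.
  rewrite -(mulrA (1 - alpha j)) [leRHS]mulrCA ler_wpM2l//.
    by have /andP[_ a1] := alpha01 j; rewrite subr_ge0.
  by apply: sqn_wvar_grad_le => i; [rewrite ltW|move=> /eqP <-; exact: le_calL_psi].
rewrite !mulr_sumr; apply: ler_sum => i _.
rewrite row_grad_localB.
have := cocoercive _ _ _ L_gt0 (f_diff i) (f_smooth i) (f_cvx i)
  (row i X) (row i X + row i H) (ltW mu_gt0).
rewrite [row i X + _ - _]addrC addKr; set br := _ - _ - _.
set gd := sqn _ => gd_le.
have /andP[pj_gt0 pj_lt1] := p01 (c i).
have q0 : 0 < 1 - p0 by rewrite subr_gt0.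
have qj : 0 < 1 - p (c i) by rewrite subr_gt0.
have br_ge0 : 0 <= br.
  by rewrite -(pmulr_rge0 _ (mulr_gt0 (ltr0n _ 2) L_gt0)) (le_trans (sqn_ge0 _) gd_le).
rewrite mulrA.
apply: (@le_trans _ _ ((1 - p0)^-1 * (1 - p (c i))^-1 * (2 * L * br))).
  by rewrite ler_wpM2l// mulr_ge0// invr_ge0 ltW.
have -> : (1 - p0)^-1 * (1 - p (c i))^-1 * (2 * L * br)
    = 2 * (L / (1 - p0) * (1 - p (c i))^-1) * br by ring.
by rewrite ler_wpM2r// ler_wpM2l// le_calL_local.
Qed.

Lemma oracle_contraction That X :
  (forall Y, Fobj That <= Fobj Y) -> 0 < eta -> 2 * eta * calL <= 1 ->
  \sum_w Pdraw p0 p w * sqn (X - eta *: Gor X w - That)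
  <= (1 - eta * mu) * sqn (X - That) + 2 * eta ^+ 2 * sigma2 That.
Proof.
move=> That_min eta_gt0 eta_le.
have XE : That + (X - That) = X by rewrite addrC subrK.
have XE' : X - (X - That) = That by rewrite opprB addrC subrK.
have step := oracle_step X That.
have noise_le := noiseD_le That (X - That); rewrite XE in noise_le.
have FX := Fobj_expand That (X - That); rewrite XE in FX.
(* Expanding also from [X] back to [That] produces the second divergence, which supplies the strong
   convexity term. *)
have FThat := Fobj_expand X (- (X - That)); rewrite XE' dotmNr in FThat.
have grad0 := minimizer_first_order That (X - That) That_min.
have cvx := bregman_ge X (- (X - That)); rewrite sqnN in cvx.
have breg_ge0 : 0 <= bregman That (X - That).
  apply: le_trans (bregman_ge _ _).
  by rewrite mulr_ge0 ?sqn_ge0// divr_ge0// ltW.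
apply: le_trans step _.
exact: contraction_arith noise_le FX FThat grad0 cvx breg_ge0.
Qed.

Lemma sigma2_ge0 X : 0 <= sigma2 X.
Proof.
have /andP[p0_gt0 p0_lt1] := p001.
rewrite /sigma2 !addr_ge0//.
- by rewrite mulr_ge0 ?sqn_ge0// divr_ge0// ltW.
- apply: sumr_ge0 => j _; rewrite mulr_ge0 ?sqn_ge0//.
  by rewrite divr_ge0 ?(ltW (psi_den_gt0 j))// mulr_ge0 ?sqr_ge0.
- rewrite mulr_ge0 ?invr_ge0 ?subr_ge0 ?(ltW p0_lt1)//; apply: sumr_ge0 => j _.
  have /andP[_ pj_lt1] := p01 j.
  by rewrite mulr_ge0 ?sqn_ge0// invr_ge0 subr_ge0 ltW.
Qed.

End ExpectedSmoothness.

(** * Unrolling the one-step recursion *)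

Theorem mainTheorem8 (R : realType) (n d k : nat)
  (c : 'I_n -> 'I_k) (gamma : 'I_n -> R) (alpha : 'I_k -> R)
  (f : 'I_n -> 'rV[R]_d -> R) (mu L : R)
  (p0 : R) (p : 'I_k -> R) (tau : 'I_k -> R)
  (eta : R) (Th0 That : 'M[R]_(n, d)) :
  (0 < d)%N ->
  (forall j : 'I_k, exists i : 'I_n, c i = j) ->
  (forall i, 0 < gamma i) ->
  (forall j, 0 <= alpha j <= 1) ->
  (exists j, alpha j != 0) ->
  0 < mu -> mu <= L ->
  (forall i (x : 'rV[R]_d), differentiable (f i) x) ->
  (forall i, strongly_convex mu (f i)) ->
  (forall i, smooth_L L (f i)) ->
  (forall Th, Fobj c gamma alpha f That <= Fobj c gamma alpha f Th) ->
  (forall Th, (forall Th', Fobj c gamma alpha f Th <= Fobj c gamma alpha f Th') ->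
     Th = That) ->
  0 < p0 < 1 ->
  (forall j, 0 < p j < 1) ->
  (forall j, tau j = p0 / (p0 + 2 * (1 - p0) * p j)) ->
  0 < eta -> eta <= (2 * calL c gamma alpha p0 p L)^-1 ->
  forall t : nat,
    expected_sqdist c gamma alpha f p0 p tau eta Th0 t That <=
      (1 - eta * mu) ^+ t * sqn (Th0 - That)
      + 2 * eta * sigma2 c gamma alpha f p0 p That / mu.
Proof.
move=> _ _ gamma_gt0 alpha01 [j _] mu_gt0 mu_le_L f_diff f_cvx f_smooth That_min _.
move=> p001 p01 tauE eta_gt0 eta_le.
have L_gt0 := lt_le_trans mu_gt0 mu_le_L.
have L_le := L_le_calL c gamma alpha mu L p0 p mu_gt0 mu_le_L p001 p01 j.
have calL_gt0 := lt_le_trans L_gt0 L_le.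
have eta_calL : 2 * eta * calL c gamma alpha p0 p L <= 1.
  rewrite mulrAC -ler_pdivlMl ?mulr1 ?mulr_gt0//.
(* The contraction factor must be nonnegative to multiply the induction hypothesis. *)
have rho_ge0 : 0 <= 1 - eta * mu.
  have : eta * mu <= eta * calL c gamma alpha p0 p L.
    by rewrite ler_pM2l// (le_trans mu_le_L).
  move: eta_calL; rewrite -mulrA; move: (eta * mu) (eta * _) => u v; lra.
have P_ge0 w : 0 <= Pdraw p0 p w.
  apply: Pdraw_ge0 => [|i]; first by have /andP[? ?] := p001; rewrite !ltW.
  by have /andP[? ?] := p01 i; rewrite !ltW.
have contraction Th := oracle_contraction c gamma alpha f mu L p0 p tau eta gamma_gt0
  alpha01 mu_gt0 mu_le_L f_diff f_cvx f_smooth p001 p01 tauE That Th That_min eta_gt0 eta_calL.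
have s2_ge0 : 0 <= sigma2 c gamma alpha f p0 p That.
  exact: sigma2_ge0.
elim=> [|t IHt].
  rewrite expected_sqdist0 expr0 mul1r lerDl.
  by rewrite divr_ge0 ?(ltW mu_gt0)// mulr_ge0// mulr_ge0// ltW.
apply: le_trans (expected_sqdist_step _ _ _ _ _ _ _ _ _ _ _ _ _ P_ge0 contraction) _.
have := ler_wpM2l rho_ge0 IHt; rewrite mulrDr mulrA -exprS.
(* The error [2 * eta * sigma2 / mu] is the fixed point of the recursion: contracting it loses
   exactly the [2 * eta ^+ 2 * sigma2] added by one step. *)
have -> : (1 - eta * mu) * (2 * eta * sigma2 c gamma alpha f p0 p That / mu) =
  2 * eta * sigma2 c gamma alpha f p0 p That / mu
  - 2 * eta ^+ 2 * sigma2 c gamma alpha f p0 p That.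
  by field; rewrite gt_eqF.
move: (_ * expected_sqdist _ _ _ _ _ _ _ _ _ _ _) (_ * sqn _).
move: (2 * eta * _ / mu) (2 * eta ^+ 2 * _) => u v w z.
clear; lra.
Qed.
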